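(* Let $\mathbb{R}_+=(0,\infty)$, $\bar{\mathbb{R}}_+=[0,\infty)$, and let $G=\mathbb{R}_+\times\mathbb{R}_+=\{(t,x): t>0,\ x>0\}$. Let $$u=u(t,x)\in C\big(\bar{\mathbb{R}}_+,\,C^1(\bar{\mathbb{R}}_+)\cap C^2(\mathbb{R}_+)\big)\cap C^1\big(\mathbb{R}_+,\,C(\mathbb{R}_+)\big)$$ be bounded on $G$ and satisfy the heat equation $$u'_t-u''_{xx}=0,\qquad (t,x)\in G.$$ Then $u$ has the boundary values $$v(x)=u(+0,x),\ x>0,\qquad \phi(t)=u(t,+0),\ t>0,\qquad \psi(t)=u'_x(t,+0),\ t>0,$$ these boundary values are continuous functions, $v,\phi,\psi\in C(\mathbb{R}_+)$, and they satisfy, for all $t>0$, $$\phi(t)=\frac{1}{\sqrt{\pi t}}\int_0^\infty e^{-\frac{\xi^2}{4t}}\,v(\xi)\,d\xi-\frac{1}{\sqrt{\pi}}\int_0^t\frac{1}{\sqrt{\tau}}\,\psi(t-\tau)\,d\tau.$$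
   Context: All functions are real-valued. In the notation $C(\bar{\mathbb{R}}_+,E)$ and $C^1(\mathbb{R}_+,E)$ the first argument is the time variable $t$ and $E$ is a space of functions of $x$. The spaces $C^k(I)$ of functions on an interval $I$ carry the topology of uniform convergence, on compact subsets of $I$, of the function and its derivatives up to order $k$. Thus the regularity hypothesis means: $u$ and $u'_x$ are (jointly) continuous on $[0,\infty)\times[0,\infty)$, $u''_{xx}$ exists and is continuous on $[0,\infty)\times(0,\infty)$, and $u'_t$ exists and is continuous on $(0,\infty)\times(0,\infty)$. The notation $u(+0,x)$, $u(t,+0)$, $u'_x(t,+0)$ denotes one-sided limits as the indicated argument tends to $0$ from above. *)

(* Defs.v *)
From mathcomp Require Import all_boot all_order all_algebra.
From mathcomp Require Import all_classical all_reals all_analysis.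

Set Implicit Arguments.
Unset Strict Implicit.
Unset Printing Implicit Defensive.

Import Order.TTheory GRing.Theory Num.Theory.
Import numFieldNormedType.Exports.

Local Open Scope classical_set_scope.
Local Open Scope ring_scope.

Definition diff_quot (R : realType) (f : R -> R) (x : R) : R -> R :=
  fun y => (f y - f x) / (y - x).

(* Derivative of f at x relative to D: only the values of f at x and on D
   matter, so at an endpoint of an interval D it is the one-sided derivative. *)
Definition derivable_within (R : realType) (D : set R) (f : R -> R) (x : R) :
    Prop :=
  cvg (diff_quot f x y @[y --> within D x^']).

Definition derive_within (R : realType) (D : set R) (f : R -> R) (x : R) : R :=
  lim (diff_quot f x y @[y --> within D x^']).

(* u = u(t, x) belongs to
     C([0, +oo[, C^1([0, +oo[) `&` C^2(]0, +oo[)) `&` C^1(]0, +oo[, C(]0, +oo[)),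
   where C^k(I) carries the topology of uniform convergence on compact subsets
   of I of the derivatives of order at most k; membership amounts to existence
   and joint continuity of the derivatives below.  Only the values of u on
   [0, +oo[ x [0, +oo[ matter. *)
Definition heat_regular (R : realType) (u : R -> R -> R) : Prop :=
  [/\ {within `[0, +oo[ `*` `[0, +oo[,
         continuous (fun p : R * R => u p.1 p.2)},
      (forall t x : R, 0 <= t -> 0 <= x ->
         derivable_within `[0, +oo[ (u t) x) /\
      {within `[0, +oo[ `*` `[0, +oo[,
         continuous (fun p : R * R => derive_within `[0, +oo[ (u p.1) p.2)},
      (forall t x : R, 0 <= t -> 0 < x -> derivable (derive1 (u t)) x 1) /\
      {within `[0, +oo[ `*` `]0, +oo[,
         continuous (fun p : R * R => derive1n 2 (u p.1) p.2)} &
      (forall t x : R, 0 < t -> 0 < x -> derivable (u ^~ x) t 1) /\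
      {within `]0, +oo[ `*` `]0, +oo[,
         continuous (fun p : R * R => derive1 (u ^~ p.2) p.1)}].

(* Main.v *)
(* Green's identity with the heat kernel k(s,x) = e^(-x^2/(4s)) / sqrt s on the
   half-line: for U(s,x) = u(T+d-s, x+d), the integral F(s) over x > 0 of k U has
   derivative U_x(s,0) / sqrt s, so that F(T) - F(d) is the time integral of the
   flux.  Since u_x is not controlled as x tends to infinity, k is multiplied by
   a cut-off living on [0, 1/d]; because |u| <= M this only costs an error
   O(M T sqrt d).  As d tends to 0, dominated convergence sends F(T) to the
   integral of k(T,.) v, the time integral to that of psi(T-s) / sqrt s and, after
   the substitution x = 2 sqrt(d) y, F(d) to sqrt(pi) phi(T). *)
Require Import Defs.
From mathcomp Require Import all_boot all_order all_algebra.
From mathcomp Require Import all_classical all_reals all_analysis.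
From mathcomp Require Import measurable_realfun ring lra.

Set Implicit Arguments.
Unset Strict Implicit.
Unset Printing Implicit Defensive.

Import Order.TTheory GRing.Theory Num.Theory.
Import numFieldNormedType.Exports.

Local Open Scope classical_set_scope.
Local Open Scope ring_scope.

(** The equation is available only for t > 0 and x > 0, so Green's identity cannot be written on the
    closed quadrant. After the shift of both variables by d, every integral runs over a compact set
    on which all integrands are continuous, and the Leibniz rule and the fundamental theorem of
    calculus apply. The kernel is singular at s = 0, so time starts at s = d. A single parameter is
    thus time shift, space shift, initial time and inverse length of the cut-off. The rate sqrt d is
    a balance: two derivatives of the cut-off w give d^2, its support has length 1/d, and k is at
    most d^(-1/2) for s >= d. The cross term 2 w' k_x has the same order, because w' carries a
    factor d^2 x and x k_x = -(x^2/(2s)) k is controlled by z e^(-z) <= 1. The error therefore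
    involves u only through its bound M; u_x enters only through the flux near x = 0, where
    compactness bounds it. *)

Lemma is_derive_continuous (R : realType) (f : R -> R) (x d : R) :
  is_derive x 1 f d -> {for x, continuous f}.
Proof.
by move=> [fx _]; exact/differentiable_continuous/derivable1_diffP.
Qed.

Lemma continuous_section (R : realType) (f : R -> R -> R) (s x : R) :
  {for (s, x), continuous (fun z : R * R => f z.1 z.2)} ->
  {for x, continuous (f s)}.
Proof.
move=> cf; apply: (@continuous2_cvg _ _ _ _ _ _ (fun=> s) id f s x cf).
  exact: cvg_cst.
exact: cvg_id.
Qed.

Lemma continuous_integrable_segment (R : realType) (f : R -> R) (a b : R) :
  (forall x, a <= x <= b -> {for x, continuous f}) ->
  (@lebesgue_measure R).-integrable `[a, b] (EFin \o f).
Proof.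
move=> cf; apply: continuous_compact_integrable; first exact: segment_compact.
by apply: continuous_in_subspaceT => x; rewrite inE/= in_itv/=; exact: cf.
Qed.

Lemma integrable_cstM (R : realType) (D : set (measurableTypeR R)) (k : R)
    (f : R -> R) : measurable D ->
  (@lebesgue_measure R).-integrable D (EFin \o f) ->
  (@lebesgue_measure R).-integrable D (EFin \o (fun x => k * f x)).
Proof. by move=> mD; exact: integrableZl. Qed.

Lemma Rintegral_is_derive (R : realType) (F f : R -> R) (a b : R) : a < b ->
  (forall x, a <= x <= b -> is_derive x 1 F (f x)) ->
  (forall x, a <= x <= b -> {for x, continuous f}) ->
  \int[lebesgue_measure]_(x in `[a, b]) f x = F b - F a.
Proof.
move=> ab dF cf.
have cF x : a <= x <= b -> {for x, continuous F}.
  by move=> /dF; exact: is_derive_continuous.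
rewrite /Rintegral (@continuous_FTC2 _ _ F)//.
- by apply: continuous_in_subspaceT => x; rewrite inE/= in_itv/=; exact: cf.
- split.
  + move=> x; rewrite in_itv/= => /andP[ax xb].
    by have [] := dF x; rewrite ?(ltW ax) ?(ltW xb).
  + by apply/cvg_at_right_filter/cF; rewrite lexx ltW.
  + by apply/cvg_at_left_filter/cF; rewrite lexx ltW.
- move=> x; rewrite in_itv/= => /andP[ax xb].
  have [_ <-] : is_derive x 1 F (f x) by apply: dF; rewrite (ltW ax) (ltW xb).
  by rewrite derive1E.
Qed.

Lemma le_norm_derive (R : realType) (f df : R -> R) (a b C : R) : a <= b ->
  (forall x, a <= x <= b -> is_derive x 1 f (df x)) ->
  (forall x, a <= x <= b -> `|df x| <= C) ->
  `|f b - f a| <= C * (b - a).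
Proof.
move=> ab fdf dfC.
have [||c cab ->] := MVT_segment ab (f := f) (df := df).
- move=> x; rewrite in_itv/= => /andP[ax xb].
  by apply: fdf; rewrite (ltW ax) (ltW xb).
- apply: continuous_in_subspaceT => x; rewrite inE/= in_itv/= => xab.
  exact: is_derive_continuous (fdf _ xab).
rewrite normrM (@ger0_norm _ (b - a)) ?subr_ge0//.
by rewrite ler_wpM2r ?subr_ge0// dfC//; rewrite in_itv/= in cab.
Qed.

Lemma bounded_rectangle (R : realType) (f : R * R -> R) (a b c d : R) :
  {within `[a, b] `*` `[c, d], continuous f} ->
  exists2 M, 0 <= M & forall x y, a <= x <= b -> c <= y <= d -> `|f (x, y)| <= M.
Proof.
move=> cf.
have cpt : compact (`[a, b] `*` `[c, d] : set (R * R)).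
  by apply: compact_setX; exact: segment_compact.
have /compact_bounded[M [_ MfM]] := continuous_compact cf cpt.
have /MfM fM : M < `|M| + 1 by rewrite (le_lt_trans (ler_norm M))// ltrDl.
exists (`|M| + 1) => [|x y xab ycd]; first by rewrite addr_ge0.
by apply: fM => /=; exists (x, y) => //=; split; rewrite /= in_itv.
Qed.

(* Leibniz rule: the derivative is dominated by its maximum on a compact
   rectangle around the line of integration. *)
Lemma is_derive_Rintegral (R : realType) (g dg : R -> R -> R)
    (p q a b s : R) : p < s < q ->
  (forall r x, p < r < q -> a <= x <= b -> is_derive r 1 (g ^~ x) (dg r x)) ->
  (forall r x, p < r < q -> a <= x <= b ->
     {for (r, x), continuous (fun z : R * R => dg z.1 z.2)}) ->
  (forall r x, p < r < q -> a <= x <= b -> {for x, continuous (g r)}) ->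
  is_derive s 1 (fun r => \int[lebesgue_measure]_(x in `[a, b]) g r x)
    (\int[lebesgue_measure]_(x in `[a, b]) dg s x).
Proof.
move=> /andP[ps sq] gdg cdg cg.
have [p' /andP[pp' p's]] : exists p', p < p' < s.
  by exists ((p + s) / 2); rewrite !midf_lt.
have [q' /andP[sq' q'q]] : exists q', s < q' < q.
  by exists ((s + q) / 2); rewrite !midf_lt.
have sub r : p' <= r <= q' -> p < r < q.
  by move=> /andP[/(lt_le_trans pp')-> /le_lt_trans->].
have [M M0 dgM] :
    exists2 M, 0 <= M & forall r x, p' <= r <= q' -> a <= x <= b -> `|dg r x| <= M.
  have := @bounded_rectangle R (fun z => dg z.1 z.2) p' q' a b; apply.
  apply: continuous_in_subspaceT => -[r x]; rewrite inE /= !in_itv/= => -[? ?].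
  by apply: cdg => //; exact: sub.
have sub' r : `]p', q'[%classic r -> p' <= r <= q'.
  by rewrite /= in_itv/= => /andP[/ltW-> /ltW->].
have Is : `]p', q'[%classic s by rewrite /= in_itv/= p's.
have dE r x : `]p', q'[%classic r -> `[a, b]%classic x ->
    partial1of2 g r x = dg r x.
  rewrite partial1of2E => /sub' r' xab.
  by apply: derive_val; apply: gdg; [exact: sub|rewrite /= in_itv in xab].
have intg r : `]p', q'[%classic r ->
    (@lebesgue_measure R).-integrable `[a, b] (EFin \o g r).
  move=> /sub'/sub pr; apply: continuous_integrable_segment => x xab.
  exact: cg xab.
have derg r x : `]p', q'[%classic r -> `[a, b]%classic x ->
    derivable (g ^~ x) r 1.
  move=> /sub'/sub pr xab.
  by have [] : is_derive r 1 (g ^~ x) (dg r x)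
    by apply: gdg => //; rewrite /= in_itv in xab.
have intM : (@lebesgue_measure R).-integrable `[a, b] (EFin \o cst M).
  by apply: continuous_integrable_segment => x _; exact: cvg_cst.
have ubM r x : `]p', q'[%classic r -> `[a, b]%classic x ->
    `|partial1of2 g r x| <= cst M x.
  move=> pr xab; rewrite dE//; apply: dgM; first exact: sub'.
  by rewrite /= in_itv in xab.
split.
- exact: (derivable_under_integral _ Is intg derg _ intM ubM).
- rewrite -derive1E.
  rewrite (differentiation_under_integral _ Is intg derg _ intM ubM)//.
  by apply: eq_Rintegral => x; rewrite inE => /(dE _ _ Is).
Qed.

(** The path has to stay in [A] only eventually, so [(x, y)] may lie on the boundary of [A]. The
    arbitrary filter [F] lets one statement serve one-sided limits at 0, limits along the sequence
    [d n], and ordinary continuity. *)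
Lemma cvg_within_comp (R : realType) (A : set (R * R)) (f : R * R -> R)
    (T : Type) (F : set_system T) {FF : Filter F} (g h : T -> R) (x y : R) :
  {within A, continuous f} -> A (x, y) -> (\forall t \near F, A (g t, h t)) ->
  g t @[t --> F] --> x -> h t @[t --> F] --> y ->
  f (g t, h t) @[t --> F] --> f (x, y).
Proof.
move=> /subspace_continuousP/(_ (x, y)) cf Axy AF gx hy.
have gh : (g t, h t) @[t --> F] --> (x, y).
  exact: (@cvg_pair _ _ _ F (nbhs x) (nbhs y) FF _ _ g h gx hy).
have {}cf := cf Axy.
apply: (@cvg_comp _ _ _ (fun t => (g t, h t)) f) cf => B /= /gh/= FB.
by apply: filterS2 AF FB => t At; apply.
Qed.

(** A point with positive coordinates is interior to [A], so relative continuity there is ordinary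
    continuity. [A] is left general because the second derivative is continuous on a smaller set
    than [u]. *)
Lemma within_quadrant_continuous (R : realType) (A : set (R * R)) (f : R * R -> R)
    (t x : R) : {within A, continuous f} ->
  (forall z : R * R, 0 < z.1 -> 0 < z.2 -> A z) -> 0 < t -> 0 < x ->
  {for (t, x), continuous f}.
Proof.
move=> cf posA t0 x0.
have c1 : z.1 @[z --> (t, x)] --> t by exact: cvg_fst.
have c2 : z.2 @[z --> (t, x)] --> x by exact: cvg_snd.
have cff := cvg_within_comp cf (posA (t, x) t0 x0) _ c1 c2.
have fE : (fun z => f (z.1, z.2)) = f by apply/funext => -[].
rewrite fE in cff; apply: cff.
near=> z; apply: posA => /=; near: z.
  exact: (c1 _ (lt_nbhsr t0)).
exact: (c2 _ (lt_nbhsr x0)).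
Unshelve. all: by end_near. Qed.

(** Dominated convergence over moving segments: extending [f_ n] by 0 outside its segment puts all
    integrals on [D], and each point of [D] is eventually in the segments, so the extensions still
    converge to [f]. Measurability of [f] comes from the limit, and its integrability is part of the
    outcome; the same lemma yields all three limits below. *)
Lemma cvg_Rintegral_segments (R : realType) (D : set (measurableTypeR R))
    (a b : nat -> R) (f_ : nat -> R -> R) (f g : R -> R) : measurable D ->
  (forall n, `[a n, b n] `<=` D) ->
  (forall n x, a n <= x <= b n -> {for x, continuous (f_ n)}) ->
  (forall x, D x -> \forall n \near \oo, a n <= x <= b n) ->
  (forall x, D x -> f_ n x @[n --> \oo] --> f x) ->
  (forall n x, a n <= x <= b n -> `|f_ n x| <= g x) ->
  (forall x, D x -> 0 <= g x) ->
  (@lebesgue_measure R).-integrable D (EFin \o g) ->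
  (@lebesgue_measure R).-integrable D (EFin \o f) /\
  \int[lebesgue_measure]_(x in `[a n, b n]) f_ n x @[n --> \oo] -->
    \int[lebesgue_measure]_(x in D) f x.
Proof.
move=> mD abD cf abx f_f fg g0 ig.
pose h : nat -> R -> R := fun n => f_ n \_ `[a n, b n].
have hE n x : a n <= x <= b n -> h n x = f_ n x.
  by move=> abnx; rewrite /h patchE mem_set//= in_itv.
have hE0 n x : ~~ (a n <= x <= b n) -> h n x = 0.
  by move=> abnx; rewrite /h patchE memNset//= in_itv/=; exact/negP.
have mh n : measurable_fun D (fun x => (h n x)%:E).
  apply/measurable_EFinP/(measurable_funS measurableT) => //.
  apply/(measurable_restrictT _ _).1 => //.
  have := continuous_integrable_segment (cf n).
  by move=> /integrableP[/measurable_EFinP].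
have hf x : D x -> (EFin \o h n) x @[n --> \oo] --> (EFin \o f) x.
  move=> Dx; apply/fine_cvgP; split; first exact: nearW.
  apply: cvg_trans (f_f x Dx); apply: near_eq_cvg.
  by near=> n; rewrite /= hE//; near: n; exact: abx.
have mf : measurable_fun D (fun x => (f x)%:E) by exact: emeasurable_fun_cvg hf.
have hg x n : D x -> (`|(EFin \o h n) x| <= (EFin \o g) x)%E.
  move=> Dx; rewrite /= lee_fin.
  have [abnx|abnx] := boolP (a n <= x <= b n); first by rewrite hE// fg.
  by rewrite hE0// normr0 g0.
have [iF _ cvgF] := dominated_convergence mD mh mf (aeW _ hf) ig
  (aeW _ (fun x n => hg x n)).
split=> //.
rewrite [X in X @ _ --> _](_ : _ =
    (fun n => fine (\int[lebesgue_measure]_(x in D) (EFin \o h n) x)%E)).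
  apply: fine_cvg; rewrite fineK//.
  exact: integrable_fin_num.
apply/funext => n; rewrite /Rintegral; congr fine.
rewrite (_ : EFin \o h n = (EFin \o f_ n) \_ `[a n, b n]); last first.
  by rewrite restrict_EFin.
by rewrite -integral_mkcondr setIC (setIidl (abD n)).
Unshelve. all: by end_near. Qed.

Lemma Rintegral_scale (R : realType) (G : R -> R) (c b : R) : 0 < c -> 0 <= b ->
  (forall x, 0 <= x <= c * b -> {for x, continuous G}) ->
  \int[lebesgue_measure]_(x in `[0, c * b]) G x =
  c * \int[lebesgue_measure]_(y in `[0, b]) G (c * y).
Proof.
move=> c0 b0 cG.
have dc (x : R) : is_derive x 1 ( *%R c : R -> R) c.
  have -> : *%R c = c *: (@id R) by apply/funext.
  by apply: is_derive_eq; rewrite /GRing.scale/= mulr1.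
have dcE : derive1 ( *%R c) = cst c.
  by apply/funext => x; rewrite derive1E; apply: derive_val.
have := @integration_by_substitution_increasing R ( *%R c) G 0 b b0.
rewrite mulr0 dcE => subst.
rewrite -RintegralZl//; last first.
  apply: continuous_integrable_segment => x /andP[x0 xb].
  apply: (@continuous_comp _ _ _ ( *%R c) G).
    exact: is_derive_continuous (dc x).
  by apply: cG; rewrite mulr_ge0 ?(ltW c0)// ler_pM2l.
rewrite /Rintegral subst//.
- by congr fine; apply: eq_integral => x _; rewrite /= fctE/= mulrC.
- by move=> x y _ _ xy; rewrite ltr_pM2l.
- by move=> x _; exact: cvg_cst.
- exact: is_cvg_cst.
- exact: is_cvg_cst.
- split => [x _||].
  + by have [] := dc x.
  + by apply: cvg_at_right_filter; exact: (is_derive_continuous (dc 0)).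
  + by apply: cvg_at_left_filter; exact: (is_derive_continuous (dc b)).
- by apply: continuous_in_subspaceT => x; rewrite inE/= in_itv/=; exact: cG.
Qed.

(** The primitive 2 sqrt s bounds the integral over each [[a n, T]] by 2 sqrt T, and monotone
    convergence along this exhaustion of []0, T]] keeps the bound. *)
Lemma integrable_inv_sqrt (R : realType) (T : R) : 0 < T ->
  (@lebesgue_measure R).-integrable `]0, T] (EFin \o (fun s => (Num.sqrt s)^-1)).
Proof.
move=> T0.
pose a (n : nat) : R := T / n.+2%:R.
have a0 n : 0 < a n by rewrite divr_gt0.
have aT n : a n < T by rewrite ltr_pdivrMr// ltr_pMr// ltr1n.
have dsqrt (s : R) : 0 < s ->
    is_derive s 1 (fun r : R => 2 * Num.sqrt r) (Num.sqrt s)^-1.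
  move=> s0; have ds := is_derive1_sqrt s0.
  have -> : (fun r : R => 2 * Num.sqrt r) = 2 *: @Num.sqrt R by apply/funext.
  apply: is_derive_eq.
  by rewrite invfM /GRing.scale/= mulrA divff ?mul1r// pnatr_eq0.
have csqrt (s : R) : 0 < s -> {for s, continuous (fun r : R => (Num.sqrt r)^-1)}.
  move=> s0; apply: cvgV; first by rewrite gt_eqF// sqrtr_gt0.
  exact: sqrt_continuous.
have msqrt0 : measurable_fun (`]0, +oo[ : set R) (fun x => (Num.sqrt x)^-1).
  apply: open_continuous_measurable_fun; first exact: interval_open.
  by move=> x; rewrite inE/= in_itv/= andbT; exact: csqrt.
have msqrt : measurable_fun (`]0, T] : set (measurableTypeR R))
    (fun x => ((Num.sqrt x)^-1)%:E).
  apply/measurable_EFinP; apply: measurable_funS msqrt0 => //.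
  exact: subset_itvl.
have sub n : `[a n, T] `<=` `]0, T].
  by apply: subset_itvr; rewrite bnd_simp.
have UaT : \bigcup_n `[a n, T]%classic = `]0, T]%classic.
  apply/seteqP; split => [x [n _ /sub]//|x/=].
  rewrite in_itv/= => /andP[x0 xT].
  have [n Tn] : exists n : nat, T / x < n.+2%:R.
    exists (Num.truncn (T / x)).
    rewrite (lt_trans (truncnS_gt _))// ltr_nat.
    by rewrite ltnS.
  exists n => //=; rewrite in_itv/= xT andbT /a ler_pdivrMr//.
  by rewrite mulrC -ler_pdivrMr// ltW.
apply/integrableP; split => //.
under eq_integral do rewrite /= ger0_norm ?invr_ge0 ?sqrtr_ge0//.
rewrite -UaT.
have nd : {homo (fun n => `[a n, T]%classic) : n m / (n <= m)%N >-> (n <= m)%O}.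
  move=> n m nm; rewrite subsetEset; apply: subset_itvr; rewrite bnd_simp.
  by rewrite ler_pM2l// lef_pV2 ?posrE// ler_nat.
pose F n : set (measurableTypeR R) := `[a n, T]%classic.
have mF n : measurable_fun (F n) (fun s => ((Num.sqrt s)^-1)%:E).
  by apply: measurable_funS (sub n) msqrt; exact: measurable_itv.
have F0 n s : F n s -> (0 <= ((Num.sqrt s)^-1)%:E)%E.
  by move=> _; rewrite lee_fin invr_ge0 sqrtr_ge0.
have := ge0_nondecreasing_set_cvg_integral (mu := lebesgue_measure)
  nd (fun n => measurable_itv _) mF F0.
move=> /cvg_lim <- //.
apply: (@le_lt_trans _ _ (2 * Num.sqrt T)%:E); last exact: ltry.
apply: lime_le.
  apply: ereal_nondecreasing_is_cvgn.
  exact: (ge0_nondecreasing_set_nondecreasing_integral lebesgue_measure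
    nd (fun n => measurable_itv _) mF F0).
apply: nearW => n.
have H0 x : a n <= x <= T -> 0 < x by move=> /andP[+ _]; exact: lt_le_trans.
have := Rintegral_is_derive (aT n) (fun x h => dsqrt x (H0 x h))
  (fun x h => csqrt x (H0 x h)).
move=> E; rewrite -[leLHS]fineK.
  rewrite lee_fin [leLHS]E lerBlDr lerDl.
  by rewrite mulr_ge0// sqrtr_ge0.
apply: integrable_fin_num => //.
by apply: continuous_integrable_segment => x /H0/csqrt.
Qed.

(** * Differentiation rules in applied form, the heat kernel and the cut-off *)

Lemma is_derive_fctM (R : realType) (f g : R -> R) (x df dg : R) :
  is_derive x 1 f df -> is_derive x 1 g dg ->
  is_derive x 1 (fun y => f y * g y) (df * g x + f x * dg).
Proof.
move=> fx gx; have := is_deriveM fx gx; rewrite /GRing.scale/= => H.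
by apply: is_derive_eq; rewrite addrC mulrC.
Qed.

Lemma is_derive_fctD (R : realType) (f g : R -> R) (x df dg : R) :
  is_derive x 1 f df -> is_derive x 1 g dg ->
  is_derive x 1 (fun y => f y + g y) (df + dg).
Proof. by move=> fx gx; exact: is_deriveD. Qed.

Lemma is_derive_fctB (R : realType) (f g : R -> R) (x df dg : R) :
  is_derive x 1 f df -> is_derive x 1 g dg ->
  is_derive x 1 (fun y => f y - g y) (df - dg).
Proof. by move=> fx gx; exact: is_deriveB. Qed.

Lemma is_derive_fct_comp (R : realType) (f g : R -> R) (x df dg : R) :
  is_derive (g x) 1 f df -> is_derive x 1 g dg ->
  is_derive x 1 (fun y => f (g y)) (df * dg).
Proof. by move=> fx gx; exact: is_derive1_comp. Qed.

Lemma is_derive_fctX2 (R : realType) (f : R -> R) (x df : R) :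
  is_derive x 1 f df -> is_derive x 1 (fun y => f y ^+ 2) (2 * f x * df).
Proof.
move=> fx; have -> : (fun y => f y ^+ 2) = (fun y => f y * f y).
  by apply/funext => y; rewrite expr2.
have := is_derive_fctM fx fx => H.
by apply: is_derive_eq; rewrite /=; ring.
Qed.

(** This is 2 sqrt(pi) times the usual fundamental solution; without that factor, pi enters only
    through the Gaussian integral in the limit at s = d. *)
Definition gauss_kernel (R : realType) (s x : R) : R :=
  (Num.sqrt s)^-1 * expR (- (x ^+ 2 / (4 * s))).

Lemma gauss_kernel_ge0 (R : realType) (s x : R) : 0 <= gauss_kernel s x.
Proof. by rewrite mulr_ge0 ?expR_ge0// invr_ge0 sqrtr_ge0. Qed.

Lemma gauss_kernel_le (R : realType) (s x : R) : 0 < s ->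
  gauss_kernel s x <= (Num.sqrt s)^-1.
Proof.
move=> s0; rewrite ler_piMr ?invr_ge0 ?sqrtr_ge0// -expR0 ler_expR oppr_le0.
by rewrite divr_ge0 ?sqr_ge0// mulr_ge0// ltW.
Qed.

(** This is y e^(-y) <= 1, from e^y >= 1 + y. It absorbs the factor x^2/s produced when one
    derivative falls on the cut-off and one on the kernel. *)
Lemma gauss_kernel_moment_le (R : realType) (s x : R) : 0 < s ->
  x ^+ 2 / (4 * s) * gauss_kernel s x <= (Num.sqrt s)^-1.
Proof.
move=> s0; set y := x ^+ 2 / (4 * s).
have y1 : y <= expR y by rewrite (le_trans _ (expR_ge1Dx y))// lerDr.
rewrite mulrCA ler_piMr ?invr_ge0 ?sqrtr_ge0//.
by rewrite expRN ler_pdivrMr ?expR_gt0// mul1r.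
Qed.

Lemma is_derive_gauss_kernel_time (R : realType) (s x : R) : 0 < s ->
  is_derive s 1 (@gauss_kernel R ^~ x)
    (gauss_kernel s x * (x ^+ 2 / (4 * s ^+ 2) - (2 * s)^-1)).
Proof.
move=> s0; have s_neq0 : s != 0 by rewrite gt_eqF.
have sq0 : Num.sqrt s != 0 by rewrite gt_eqF// sqrtr_gt0.
have dsq := is_derive1_sqrt s0.
have dsqV := is_deriveV sq0 dsq.
have dV : is_derive s 1 (fun r : R => r^-1) (- s ^- 2).
  have := @is_deriveV R id s 1 1 s_neq0 (is_derive_id _ _) => H.
  by apply: is_derive_eq; rewrite /GRing.scale/= mulr1.
have -> : (@gauss_kernel R ^~ x) =
    (fun r => (Num.sqrt r)^-1 * expR (- (x ^+ 2 / 4) * r^-1)).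
  by apply/funext => r; rewrite /gauss_kernel invfM mulrA mulNr.
have darg := is_derive_fctM (is_derive_cst (- (x ^+ 2 / 4) : R) s (1 : R)) dV.
have dexp := is_derive_fct_comp (is_derive_expR _) darg.
have := is_derive_fctM dsqV dexp => H.
apply: is_derive_eq; rewrite /GRing.scale/= /gauss_kernel.
rewrite (_ : - (x ^+ 2 / 4) / s = - (x ^+ 2 / (4 * s))); last by field.
set e := expR _.
have sE : s = Num.sqrt s ^+ 2 by rewrite sqr_sqrtr// ltW.
rewrite [in LHS](_ : s ^- 2 = (s * s)^-1) ?expr2//.
(* With s written as q^2, the identity becomes rational in q. *)
move: sq0 sE; set q := Num.sqrt s => q0 sE.
rewrite sE; field.
by rewrite q0.
Qed.

Lemma is_derive_gauss_kernel_space (R : realType) (s x : R) : 0 < s ->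
  is_derive x 1 (gauss_kernel s) (- (x / (2 * s)) * gauss_kernel s x).
Proof.
move=> s0; have s_neq0 : s != 0 by rewrite gt_eqF.
have -> : gauss_kernel s =
    (fun y => (Num.sqrt s)^-1 * expR (y ^+ 2 * - (4 * s)^-1)).
  by apply/funext => y; rewrite /gauss_kernel mulrN.
have darg := is_derive_fctM (is_derive_fctX2 (is_derive_id x (1 : R)))
  (is_derive_cst (- (4 * s)^-1 : R) x (1 : R)).
have dexp := is_derive_fct_comp (is_derive_expR _) darg.
have := is_derive_fctM (is_derive_cst ((Num.sqrt s)^-1) x (1 : R)) dexp => H.
apply: is_derive_eq.
have q0 : Num.sqrt s != 0 by rewrite gt_eqF// sqrtr_gt0.
rewrite /= mulrN /gauss_kernel; set e := expR _.
by field; rewrite q0 s_neq0.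
Qed.

Lemma continuous_gauss_kernel (R : realType) (s x : R) : 0 < s ->
  {for (s, x), continuous (fun z : R * R => gauss_kernel z.1 z.2)}.
Proof.
move=> s0; rewrite /gauss_kernel.
have c1 : z.1 @[z --> (s, x)] --> s by exact: cvg_fst.
have c2 : z.2 @[z --> (s, x)] --> x by exact: cvg_snd.
apply: cvgM.
  apply: cvgV; first by rewrite gt_eqF// sqrtr_gt0.
  exact: (cvg_comp _ _ c1 (@sqrt_continuous _ _)).
apply: (@cvg_comp _ _ _ _ expR); last exact: continuous_expR.
apply: cvgN; apply: cvgM.
  rewrite expr2; under eq_fun do rewrite expr2.
  exact: cvgM.
apply: cvgV; first by rewrite mulf_neq0// gt_eqF.
by apply: cvgM => //; exact: cvg_cst.
Qed.

(* [cutoff d] is 1 with zero derivative at 0 and has a double zero at [d^-1],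
   so that on [0, d^-1] Green's identity has no boundary term except the flux
   at 0. *)
Definition cutoff (R : realType) (d x : R) : R := (1 - (d * x) ^+ 2) ^+ 2.

Lemma cutoff_itv (R : realType) (d x : R) : 0 < d -> 0 <= x <= d^-1 ->
  0 <= (d * x) ^+ 2 <= 1.
Proof.
move=> d0 /andP[x0 xd]; rewrite sqr_ge0/= expr_le1//.
  by rewrite -ler_pdivlMl// mulr1.
by rewrite mulr_ge0// ltW.
Qed.

Lemma norm_cutoff_le1 (R : realType) (d x : R) : 0 < d -> 0 <= x <= d^-1 ->
  `|cutoff d x| <= 1.
Proof.
move=> d0 /(cutoff_itv d0)/andP[y0 y1].
rewrite ger0_norm ?sqr_ge0// expr_le1//; first by rewrite gerBl.
by rewrite subr_ge0.
Qed.

Lemma is_derive_cutoff (R : realType) (d x : R) :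
  is_derive x 1 (cutoff d) (- 4 * d ^+ 2 * x * (1 - (d * x) ^+ 2)).
Proof.
have dl := is_derive_fctM (is_derive_cst d x (1 : R)) (is_derive_id x (1 : R)).
have := is_derive_fctX2 (is_derive_fctB (is_derive_cst (1 : R) x (1 : R))
  (is_derive_fctX2 dl)) => H.
by apply: is_derive_eq; rewrite /=; ring.
Qed.

Lemma is_derive2_cutoff (R : realType) (d x : R) :
  is_derive x 1 (fun y => - 4 * d ^+ 2 * y * (1 - (d * y) ^+ 2))
    (4 * d ^+ 2 * (3 * (d * x) ^+ 2 - 1)).
Proof.
have dl := is_derive_fctM (is_derive_cst d x (1 : R)) (is_derive_id x (1 : R)).
have dl' := is_derive_fctM (is_derive_cst (- 4 * d ^+ 2) x (1 : R))
  (is_derive_id x (1 : R)).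
have := is_derive_fctM dl' (is_derive_fctB (is_derive_cst (1 : R) x (1 : R))
  (is_derive_fctX2 dl)) => H.
by apply: is_derive_eq; rewrite /=; ring.
Qed.

(** * Green's identity with cut-off, at a fixed d *)

Section heat_estimate.
Variables (R : realType) (u ux uxx : R -> R -> R) (M : R).
Hypothesis u_le : forall t x : R, 0 < t -> 0 < x -> `|u t x| <= M.
Hypothesis u_dx : forall t x : R, 0 < t -> 0 < x -> is_derive x 1 (u t) (ux t x).
Hypothesis ux_dx : forall t x : R, 0 < t -> 0 < x -> is_derive x 1 (ux t) (uxx t x).
Hypothesis u_dt : forall t x : R, 0 < t -> 0 < x -> is_derive t 1 (u ^~ x) (uxx t x).
Hypothesis u_cont : forall t x : R, 0 < t -> 0 < x ->
  {for (t, x), continuous (fun z : R * R => u z.1 z.2)}.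
Hypothesis ux_cont : forall t x : R, 0 < t -> 0 < x ->
  {for (t, x), continuous (fun z : R * R => ux z.1 z.2)}.
Hypothesis uxx_cont : forall t x : R, 0 < t -> 0 < x ->
  {for (t, x), continuous (fun z : R * R => uxx z.1 z.2)}.
Variables (d T : R).
Hypothesis d_gt0 : 0 < d.
Hypothesis dT : d < T.

(* Time is reversed and both variables are shifted by [d], away from the
   boundary of the quadrant. *)
Let rev (f : R -> R -> R) (s x : R) : R := f (T + d - s) (x + d).

(** On this set both arguments of [rev] are positive. The time interval is open and contains
    [[d, T]], so two-sided derivatives make sense at the end times [d] and [T]. *)
Let dom (s x : R) := 0 < s < T + d /\ 0 <= x <= d^-1.

Let domP (s x : R) : dom s x -> [/\ 0 < s, 0 < T + d - s & 0 < x + d].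
Proof.
by move=> [/andP[s0 sT] /andP[x0 _]]; split=> //; rewrite ?subr_gt0// ltr_wpDl.
Qed.

Let rev_cont (f : R -> R -> R) (s x : R) :
  (forall t x : R, 0 < t -> 0 < x ->
    {for (t, x), continuous (fun z : R * R => f z.1 z.2)}) ->
  dom s x -> {for (s, x), continuous (fun z : R * R => rev f z.1 z.2)}.
Proof.
move=> cf /domP[_ t0 x0].
apply: (@continuous2_cvg _ _ _ _ _ _ (fun z : R * R => T + d - z.1)
  (fun z : R * R => z.2 + d) f (T + d - s) (x + d)).
- exact: cf.
- by apply: cvgB; [exact: cvg_cst|exact: cvg_fst].
- by apply: cvgD; [exact: cvg_snd|exact: cvg_cst].
Qed.

Let rev_dx (f f' : R -> R -> R) (s x : R) :
  (forall t x : R, 0 < t -> 0 < x -> is_derive x 1 (f t) (f' t x)) ->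
  dom s x -> is_derive x 1 (rev f s) (rev f' s x).
Proof.
move=> ff' /domP[_ t0 x0].
have dl : is_derive x 1 (fun y => y + d) (1 + 0).
  exact: is_derive_fctD (is_derive_id x (1 : R)) (is_derive_cst d x (1 : R)).
have := @is_derive_fct_comp R (f (T + d - s)) (+%R^~ d) _ _ _ (ff' _ _ t0 x0) dl => H.
by apply: is_derive_eq; rewrite addr0 mulr1.
Qed.

Let rev_dt (s x : R) : dom s x -> is_derive s 1 (rev u ^~ x) (- rev uxx s x).
Proof.
move=> /domP[_ t0 x0].
have dl : is_derive s 1 (fun r => T + d - r) (0 - 1).
  exact: is_derive_fctB (is_derive_cst (T + d) s (1 : R)) (is_derive_id s (1 : R)).
have := @is_derive_fct_comp R (u ^~ (x + d)) (fun r => T + d - r) _ _ _ (u_dt t0 x0) dl => H.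
by apply: is_derive_eq; rewrite sub0r mulrN1.
Qed.

Let w : R -> R := cutoff d.
Let w' (x : R) := - 4 * d ^+ 2 * x * (1 - (d * x) ^+ 2).
Let w'' (x : R) := 4 * d ^+ 2 * (3 * (d * x) ^+ 2 - 1).
Let k := @gauss_kernel R.

Let g (s x : R) := w x * k s x * rev u s x.
(** The heat equation is already built in: the time derivative of the reversed [u] is written as
    [- rev uxx], as [u_dt] allows. *)
Let dg (s x : R) := w x * k s x *
  ((x ^+ 2 / (4 * s ^+ 2) - (2 * s)^-1) * rev u s x - rev uxx s x).
(** This is (w'' k + 2 w' k_x) U, since k_x = -(x/(2s)) k. With P = (w k)_x U - w k U_x, the terms
    in U_x cancel in P_x, and k_xx = k_s identifies what remains, apart from the derivatives of w,
    with [dg]. *)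
Let err (s x : R) := (w'' x - w' x * x / s) * k s x * rev u s x.
(* Green's identity: P(s, .)' = dg + err. *)
Let P (s x : R) := (w' x - w x * (x / (2 * s))) * k s x * rev u s x
  - w x * k s x * rev ux s x.

Let g_dt (s x : R) : dom s x -> is_derive s 1 (g ^~ x) (dg s x).
Proof.
move=> sx; have [s0 _ _] := domP sx.
have := is_derive_fctM (is_derive_fctM (is_derive_cst (w x) s (1 : R))
  (is_derive_gauss_kernel_time x s0)) (rev_dt sx) => H.
by apply: is_derive_eq; rewrite /dg /k /=; ring.
Qed.

Let P_dx (s x : R) : dom s x -> is_derive x 1 (P s) (dg s x + err s x).
Proof.
move=> sx; have [s0 _ _] := domP sx.
have dw := is_derive_cutoff d x.
have dw' := is_derive2_cutoff d x.
have dk := is_derive_gauss_kernel_space x s0.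
have du := rev_dx u_dx sx.
have dux := rev_dx ux_dx sx.
have dxs := is_derive_fctM (is_derive_id x (1 : R))
  (is_derive_cst ((2 * s)^-1) x (1 : R)).
have := is_derive_fctB (is_derive_fctM (is_derive_fctM
  (is_derive_fctB dw' (is_derive_fctM dw dxs)) dk) du)
  (is_derive_fctM (is_derive_fctM dw dk) dux) => H.
apply: is_derive_eq; rewrite /dg /err /w' /w'' /w /k /=.
by field; rewrite gt_eqF.
Qed.

Let cont_snd (f : R -> R) (s x : R) : {for x, continuous f} ->
  {for (s, x), continuous (fun z : R * R => f z.2)}.
Proof.
move=> cf; have c2 : z.2 @[z --> (s, x)] --> x by exact: cvg_snd.
exact: (cvg_comp _ _ c2 cf).
Qed.

Let w_cont (s x : R) : {for (s, x), continuous (fun z : R * R => w z.2)}.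
Proof. apply: cont_snd; exact: is_derive_continuous (is_derive_cutoff d x). Qed.

Let dg_cont (s x : R) : dom s x -> {for (s, x), continuous (fun z => dg z.1 z.2)}.
Proof.
move=> sx; have [s0 _ _] := domP sx.
have c1 : z.1 @[z --> (s, x)] --> s by exact: cvg_fst.
have c2 : z.2 @[z --> (s, x)] --> x by exact: cvg_snd.
apply: cvgM; first by apply: cvgM; [exact: w_cont|exact: continuous_gauss_kernel].
apply: cvgB; last exact: (rev_cont uxx_cont sx).
apply: cvgM; last exact: (rev_cont u_cont sx).
apply: cvgB; last first.
  apply: cvgV; first by rewrite mulf_neq0// gt_eqF.
  by apply: cvgM => //; exact: cvg_cst.
rewrite !expr2; under eq_fun do rewrite !expr2.
apply: cvgM; first exact: cvgM.
apply: cvgV; first by rewrite !mulf_neq0// gt_eqF.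
by apply: cvgM; [exact: cvg_cst|exact: cvgM].
Qed.

Let err_cont (s x : R) : dom s x -> {for (s, x), continuous (fun z => err z.1 z.2)}.
Proof.
move=> sx; have [s0 _ _] := domP sx.
have c1 : z.1 @[z --> (s, x)] --> s by exact: cvg_fst.
have c2 : z.2 @[z --> (s, x)] --> x by exact: cvg_snd.
have cw' : {for x, continuous w'}.
  exact: is_derive_continuous (is_derive2_cutoff d x).
have cw'' : {for x, continuous w''}.
  apply: cvgM; first exact: cvg_cst.
  apply: cvgB; last exact: cvg_cst.
  apply: cvgM; first exact: cvg_cst.
  under eq_fun do rewrite expr2.
  rewrite expr2; apply: cvgM; apply: cvgM;
    by [exact: cvg_cst|exact: cvg_id].
apply: cvgM; last exact: (rev_cont u_cont sx).
apply: cvgM; last exact: continuous_gauss_kernel.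
apply: cvgB; first exact: cont_snd.
apply: cvgM.
  by apply: cvgM => //; exact: cont_snd.
by apply: cvgV => //; rewrite gt_eqF.
Qed.

(** With Y = (d x)^2 in [0, 1] and z = x^2/(4s), the bracket is d^2 (4 (3 Y - 1) + 16 z (1 - Y)), of
    absolute value at most d^2 (8 + 16 z). Both k and z k are at most s^(-1/2), whence 24 = 8 +
    16. *)
Let err_le (s x : R) : dom s x -> `|err s x| <= 24 * d ^+ 2 * M * (Num.sqrt s)^-1.
Proof.
move=> sx; have [s0 t0 x0] := domP sx.
have M0 : 0 <= M by rewrite (le_trans _ (u_le t0 x0)).
have /andP[y0 y1] := cutoff_itv d_gt0 sx.2.
have uM : `|rev u s x| <= M by exact: u_le.
have k0 := gauss_kernel_ge0 s x.
have k1 := gauss_kernel_le x s0.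
have k2 := gauss_kernel_moment_le x s0.
have z0 : 0 <= x ^+ 2 / (4 * s) by rewrite divr_ge0 ?sqr_ge0// mulr_ge0// ltW.
rewrite /err /k.
have -> : w'' x - w' x * x / s = 4 * d ^+ 2 * (3 * (d * x) ^+ 2 - 1)
    + 16 * d ^+ 2 * (x ^+ 2 / (4 * s)) * (1 - (d * x) ^+ 2).
  by rewrite /w'' /w'; field; rewrite gt_eqF.
move: y0 y1 k2 z0; set Y := (d * x) ^+ 2; set z := x ^+ 2 / (4 * s) => y0 y1 k2 z0.
have D0 : 0 <= d ^+ 2 by exact: sqr_ge0.
have A1 : `|4 * d ^+ 2 * (3 * Y - 1) + 16 * d ^+ 2 * z * (1 - Y)|
    <= d ^+ 2 * (8 + 16 * z).
  rewrite (_ : 4 * d ^+ 2 * (3 * Y - 1) + 16 * d ^+ 2 * z * (1 - Y) =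
    d ^+ 2 * (4 * (3 * Y - 1) + 16 * (z * (1 - Y)))); last by ring.
  rewrite normrM (ger0_norm D0) ler_wpM2l// ler_norml.
  have zY0 : 0 <= z * (1 - Y) by rewrite mulr_ge0// subr_ge0.
  have zY1 : z * (1 - Y) <= z by rewrite ler_piMr// gerBl.
  by apply/andP; split; lra.
rewrite normrM (normrM _ (gauss_kernel s x)) (ger0_norm k0).
apply: (@le_trans _ _ (d ^+ 2 * (8 + 16 * z) * gauss_kernel s x * M)).
  apply: ler_pM => //; first by rewrite mulr_ge0.
  by rewrite ler_wpM2r.
rewrite (_ : d ^+ 2 * (8 + 16 * z) * gauss_kernel s x * M = d ^+ 2 * M *
  (8 * gauss_kernel s x + 16 * (z * gauss_kernel s x))); last by ring.
rewrite [leRHS](_ : _ = d ^+ 2 * M * (24 * (Num.sqrt s)^-1)); last by ring.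
rewrite ler_wpM2l ?(mulr_ge0 D0 M0)//; lra.
Qed.

Let invd_gt0 : 0 < d^-1. Proof. by rewrite invr_gt0. Qed.

Let T_gt0 : 0 < T. Proof. exact: lt_trans dT. Qed.

(** [P s] vanishes at [d^-1], where w and w' do; at 0, w = 1, w' = 0 and k = s^(-1/2), so only the
    flux remains, with a plus sign because 0 is the lower limit. *)
Let Rintegral_dg (s : R) : 0 < s < T + d ->
  \int[lebesgue_measure]_(x in `[0, d^-1]) dg s x =
  (Num.sqrt s)^-1 * ux (T + d - s) d
  - \int[lebesgue_measure]_(x in `[0, d^-1]) err s x.
Proof.
move=> sT; have s0 : s != 0 by move: sT => /andP[/gt_eqF->].
have cdg x : 0 <= x <= d^-1 -> {for x, continuous (dg s)}.
  by move=> xd; apply: continuous_section; exact: dg_cont.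
have cerr x : 0 <= x <= d^-1 -> {for x, continuous (err s)}.
  by move=> xd; apply: continuous_section; exact: err_cont.
apply/eqP; rewrite eq_sym subr_eq eq_sym; apply/eqP.
rewrite -RintegralD//; last 2 first.
- exact: continuous_integrable_segment.
- exact: continuous_integrable_segment.
transitivity (P s d^-1 - P s 0); last first.
- rewrite /P /w' /w /cutoff /k /rev /gauss_kernel mulfV ?gt_eqF//.
  by rewrite !(mulr0, mul0r, expr0n, oppr0, expR0, subr0, add0r, expr1n,
    subrr, mulr1, mul1r, sub0r, opprK)//=; ring.
- apply: Rintegral_is_derive => [|x xd|x xd].
  + exact: invd_gt0.
  + exact: P_dx.
  + by apply: cvgD; [exact: cdg|exact: cerr].
Qed.

(** The factor d^2 meets an interval of length 1/d, and s >= d replaces s^(-1/2) by d^(-1/2), giving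
    a bound uniform in time. *)
Let Rintegral_err_le (s : R) : d <= s <= T ->
  `|\int[lebesgue_measure]_(x in `[0, d^-1]) err s x| <=
  24 * M * d * (Num.sqrt d)^-1.
Proof.
move=> /andP[ds sT]; have s0 : 0 < s by exact: lt_le_trans ds.
have sTd : 0 < s < T + d by rewrite s0/= (le_lt_trans sT)// ltrDl.
have cerr x : 0 <= x <= d^-1 -> {for x, continuous (err s)}.
  by move=> xd; apply: continuous_section; exact: err_cont.
have M0 : 0 <= M by rewrite (le_trans _ (u_le T_gt0 T_gt0)).
apply: (le_trans (le_normr_Rintegral _ _)) => //.
  exact: continuous_integrable_segment.
apply: (@le_trans _ _ (\int[lebesgue_measure]_(x in `[0, d^-1])
    (24 * d ^+ 2 * M * (Num.sqrt d)^-1))).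
  apply: le_Rintegral => //.
  - apply: continuous_integrable_segment => x xd.
    by apply: cvg_norm; exact: cerr.
  - by apply: continuous_integrable_segment => x _; exact: cvg_cst.
  - move=> x; rewrite /= in_itv/= => xd.
    apply: (le_trans (err_le _)) => //.
    have c0 : 0 <= 24 * d ^+ 2 * M by rewrite !mulr_ge0// ltW.
    by rewrite ler_wpM2l// lef_pV2 ?posrE ?sqrtr_gt0// ler_wsqrtr.
rewrite Rintegral_cst//= lebesgue_measure_itv/= lte_fin invd_gt0/= subr0.
by rewrite le_eqVlt; apply/orP; left; apply/eqP; field; rewrite !gt_eqF// sqrtr_gt0.
Qed.

(** Let F be the space integral and H a primitive of the flux term. Then F - H has derivative minus
    the integral of [err], and the mean value inequality on [[d, T]] gives the factor T - d. *)
Lemma heat_cutoff_estimate :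
  `|\int[lebesgue_measure]_(x in `[0, d^-1])
      (cutoff d x * gauss_kernel T x * u d (x + d))
    - \int[lebesgue_measure]_(x in `[0, d^-1])
      (cutoff d x * gauss_kernel d x * u T (x + d))
    - \int[lebesgue_measure]_(s in `[d, T])
      ((Num.sqrt s)^-1 * ux (T + d - s) d)|
  <= 24 * M * d * (Num.sqrt d)^-1 * (T - d).
Proof.
pose F s := \int[lebesgue_measure]_(x in `[0, d^-1]) g s x.
have dF s : 0 < s < T + d -> is_derive s 1 F
    (\int[lebesgue_measure]_(x in `[0, d^-1]) dg s x).
  move=> sT; apply: (is_derive_Rintegral sT) => r x rT xd.
  - exact: g_dt.
  - exact: dg_cont.
  - have [r0 _ _] := domP (conj rT xd).
    apply: (@continuous_section R g); apply: cvgM; last exact: (rev_cont u_cont).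
    by apply: cvgM; [exact: w_cont|exact: continuous_gauss_kernel].
pose h s := (Num.sqrt s)^-1 * ux (T + d - s) d.
have ch s : 0 < s < T + d -> {for s, continuous h}.
  move=> /andP[s0 sT]; apply: cvgM.
    apply: cvgV; first by rewrite gt_eqF// sqrtr_gt0.
    exact: sqrt_continuous.
  apply: (@continuous2_cvg _ _ _ _ _ _ (fun r => T + d - r) (fun=> d) ux
    (T + d - s) d).
  - by apply: ux_cont => //; rewrite subr_gt0.
  - by apply: cvgB; [exact: cvg_cst|exact: cvg_id].
  - exact: cvg_cst.
have ih (a b : R) : 0 < a -> b < T + d ->
    (@lebesgue_measure R).-integrable `[a, b] (EFin \o h).
  move=> a0 bT; apply: continuous_integrable_segment => s /andP[as_ sb].
  by apply: ch; rewrite (lt_le_trans a0)//= (le_lt_trans sb).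
(* The base point d/2 lies strictly between the singularity at 0 and d, so H is differentiable at s
   = d as well; only its increment from d to T matters. *)
pose H s := \int[lebesgue_measure]_(r in `[d / 2, s]) h r.
have d20 : 0 < d / 2 by rewrite divr_gt0.
have d2d : d / 2 < d by rewrite ltr_pdivrMr// ltr_pMr// ltr1n.
have dH s : d <= s <= T -> is_derive s 1 H (h s).
  move=> /andP[ds sT].
  have [] := @continuous_FTC1_closed R h (d / 2) s (T + d / 2).
  - by rewrite (le_lt_trans sT)// ltrDl.
  - by apply: ih => //; rewrite ltrD2l.
  - exact: lt_le_trans ds.
  - by apply: ch; rewrite (lt_le_trans d_gt0 ds)/= (le_lt_trans sT)// ltrDl.
  - by move=> Hd HE; split=> //; rewrite -derive1E.
have HE : H T - H d = \int[lebesgue_measure]_(s in `[d, T]) h s.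
  rewrite /H Rintegral_itvB.
  - by rewrite Rintegral_itv_obnd_cbnd//; apply: integrableS (ih d T _ _) => //;
      [exact: subset_itv_oc_cc|rewrite ltrDl].
  - by apply: ih => //; rewrite ltrDl.
  - by rewrite bnd_simp ltW.
  - by rewrite bnd_simp ltW.
have -> : \int[lebesgue_measure]_(x in `[0, d^-1])
    (cutoff d x * gauss_kernel T x * u d (x + d)) = F T.
  by apply: eq_Rintegral => x _; rewrite /g /rev (addrAC T) subrr add0r.
have -> : \int[lebesgue_measure]_(x in `[0, d^-1])
    (cutoff d x * gauss_kernel d x * u T (x + d)) = F d.
  by apply: eq_Rintegral => x _; rewrite /g /rev addrK.
rewrite -HE (_ : F T - F d - (H T - H d) = (F T - H T) - (F d - H d)); last by ring.
apply: (@le_norm_derive R (fun s => F s - H s)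
  (fun s => - \int[lebesgue_measure]_(x in `[0, d^-1]) err s x)) => [|s sT|s sT].
- exact: ltW.
- have sTd : 0 < s < T + d.
    by case/andP: sT => /(lt_le_trans d_gt0)->/= /le_lt_trans->//; rewrite ltrDl.
  have := is_derive_fctB (dF s sTd) (dH s sT) => E.
  by apply: is_derive_eq; rewrite Rintegral_dg// /h; ring.
- by rewrite normrN Rintegral_err_le.
Qed.

End heat_estimate.

(** Near a positive x the half-line is a full neighbourhood, so the relative difference quotient,
    read at y = h + x, is the usual one. *)
Lemma is_derive_within (R : realType) (f : R -> R) (x : R) : 0 < x ->
  derivable_within `[0, +oo[ f x ->
  is_derive x 1 f (derive_within `[0, +oo[ f x).
Proof.
move=> x0 df.
have shift_cvg : h + x @[h --> 0^'] --> within `[0, +oo[%classic x^'.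
  move=> B; rewrite /within/= /dnbhs /within/= => HB.
  have cx : h + x @[h --> (0 : R)] --> x.
    by rewrite -[X in _ --> X]add0r; apply: cvgD; [exact: cvg_id|exact: cvg_cst].
  have HB' := cx _ HB; have Hx := cx _ (lt_nbhsr x0).
  suff : \forall h \near (0 : R), h != 0 -> B (h + x) by [].
  near=> h.
  have Bh : h + x != x -> h + x \in `[0, +oo[ -> B (h + x).
    by near: h; exact: HB'.
  have hx0 : 0 < h + x by near: h; exact: Hx.
  move=> hn0; apply: Bh; first by rewrite -subr_eq0 addrK.
  by rewrite in_itv/= andbT ltW.
have dq : h^-1 *: ((f \o shift x) (h *: (1 : R)) - f x) @[h --> 0^'] -->
    derive_within `[0, +oo[ f x.
  rewrite [X in X @ _](_ : _ = diff_quot f x \o (fun h => h + x)); last first.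
    apply/funext => h; rewrite /diff_quot /= /GRing.scale/= mulr1.
    by rewrite addrK mulrC.
  exact: (cvg_comp _ _ shift_cvg df).
by split; [apply/cvg_ex; eexists; exact: dq|exact/cvg_lim].
Unshelve. all: by end_near. Qed.

Lemma integrable_gauss_kernel (R : realType) (t : R) : 0 < t ->
  (@lebesgue_measure R).-integrable `[0, +oo[ (EFin \o gauss_kernel t).
Proof.
(* The exponent x^2/(4t) is x^2/(2 sigma^2) for sigma^2 = 2t: the kernel is a multiple of a centred
   normal density. *)
move=> t0; pose sigma : R := Num.sqrt (2 * t).
have s2 : sigma ^+ 2 = 2 * t by rewrite sqr_sqrtr// mulr_ge0// ltW.
have sn0 : sigma != 0 by rewrite gt_eqF// sqrtr_gt0 mulr_gt0.
have pk : normal_peak sigma != 0.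
  rewrite /normal_peak invr_neq0// gt_eqF// sqrtr_gt0 mulrn_wgt0//.
  by rewrite mulr_gt0 ?pi_gt0// s2 mulr_gt0.
have iN : (@lebesgue_measure R).-integrable `[0, +oo[
    (fun x => (normal_pdf 0 sigma x)%:E).
  by apply: integrableS (integrable_normal_pdf 0 sigma).
have mD : measurable (`[0, +oo[ : set (measurableTypeR R)).
  exact: measurable_itv.
have := integrableZl mD ((Num.sqrt t)^-1 / normal_peak sigma) iN.
apply: eq_integrable => // x _ /=.
rewrite /normal_pdf (negbTE sn0) /normal_fun -EFinM mulrA divfK//.
rewrite s2 subr0 /gauss_kernel; congr (_ * expR _)%:E.
by field; rewrite gt_eqF.
Qed.

Lemma Rintegral_gauss0y (R : realType) :
  \int[lebesgue_measure]_(y in `[0, +oo[) expR (- y ^+ 2) = Num.sqrt pi / 2 :> R.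
Proof. by rewrite /Rintegral integral0y_gauss. Qed.

Lemma integrable_gauss0y (R : realType) :
  (@lebesgue_measure R).-integrable `[0, +oo[ (EFin \o (fun y => expR (- y ^+ 2))).
Proof. by apply: integrableS integrableT_gauss. Qed.

Lemma integrable_gauss_kernelM (R : realType) (t : R) (v : R -> R) : 0 < t ->
  (@lebesgue_measure R).-integrable `[0, +oo[
    (EFin \o (fun x => gauss_kernel t x * v x)) ->
  (@lebesgue_measure R).-integrable `]0, +oo[
    (EFin \o (fun x => expR (- (x ^+ 2 / (4 * t))) * v x)) /\
  \int[lebesgue_measure]_(x in `[0, +oo[) (gauss_kernel t x * v x) =
  (Num.sqrt t)^-1 *
    \int[lebesgue_measure]_(x in `]0, +oo[) (expR (- (x ^+ 2 / (4 * t))) * v x).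
Proof.
move=> t0 ikv.
have st0 : Num.sqrt t != 0 by rewrite gt_eqF// sqrtr_gt0.
have ikv' : (@lebesgue_measure R).-integrable `]0, +oo[
    (EFin \o (fun x => gauss_kernel t x * v x)).
  apply: integrableS ikv => //.
  by apply: subset_itvr; rewrite bnd_simp.
have iev : (@lebesgue_measure R).-integrable `]0, +oo[
    (EFin \o (fun x => expR (- (x ^+ 2 / (4 * t))) * v x)).
  have mD : measurable (`]0, +oo[ : set (measurableTypeR R)).
    exact: measurable_itv.
  have := integrableZl mD (Num.sqrt t) ikv'.
  apply: eq_integrable => // x _ /=.
  by rewrite -EFinM /gauss_kernel !mulrA divff// mul1r.
split=> //.
rewrite -Rintegral_itv_obnd_cbnd// -RintegralZl//.
by apply: eq_Rintegral => x _; rewrite /gauss_kernel mulrA.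
Qed.

(** * The three limits along a sequence d tending to 0 *)

Section boundary_limits.
Variables (R : realType) (u ux : R -> R -> R) (M T : R).
Let Q : set (R * R) := `[0, +oo[ `*` `[0, +oo[.
Hypothesis u_le : forall t x : R, 0 < t -> 0 < x -> `|u t x| <= M.
Hypothesis u_cont : {within Q, continuous (fun p : R * R => u p.1 p.2)}.
Hypothesis ux_cont : {within Q, continuous (fun p : R * R => ux p.1 p.2)}.
Hypothesis T_gt0 : 0 < T.
Variable d : nat -> R.
Hypothesis d_gt0 : forall n, 0 < d n.
Hypothesis dT : forall n, d n < T.
Hypothesis d_cvg0 : d n @[n --> \oo] --> 0.

Let QP (t x : R) : 0 <= t -> 0 <= x -> Q (t, x).
Proof. by move=> t0 x0; split; rewrite /= in_itv/= andbT. Qed.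

Let M_ge0 : 0 <= M.
Proof. exact: le_trans (u_le T_gt0 T_gt0). Qed.

Let u_section (t x : R) : 0 < t -> 0 < x -> {for x, continuous (u t)}.
Proof.
move=> t0 x0; apply: continuous_section.
apply: (within_quadrant_continuous u_cont) => // -[s y] /= s0 y0.
by apply: QP; exact: ltW.
Qed.

(** The cut-off depends only on the product d x. The point may vary with n, as it does after the
    rescaling of the trace integral. *)
Let cutoff_cvg1 (x : nat -> R) : d n * x n @[n --> \oo] --> 0 ->
  cutoff (d n) (x n) @[n --> \oo] --> (1 : R).
Proof.
move=> dx0; rewrite (_ : (fun n => _) = cutoff 1 \o (fun n => d n * x n)); last first.
  by apply/funext => n; rewrite /cutoff /= mul1r.
rewrite [X in _ --> X](_ : 1 = cutoff 1 0); last first.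
  by rewrite /cutoff mulr0 expr0n subr0 expr1n.
have cc := is_derive_continuous (is_derive_cutoff (1 : R) 0).
exact: (cvg_comp _ _ dx0 cc).
Qed.

Let d_cvg0M (x : R) : d n * x @[n --> \oo] --> 0.
Proof.
by rewrite -[X in _ --> X](mul0r x); apply: cvgM => //; exact: cvg_cst.
Qed.

Lemma cvg_initial_integral :
  (@lebesgue_measure R).-integrable `[0, +oo[
    (EFin \o (fun x => gauss_kernel T x * u 0 x)) /\
  \int[lebesgue_measure]_(x in `[0, (d n)^-1])
    (cutoff (d n) x * gauss_kernel T x * u (d n) (x + d n)) @[n --> \oo] -->
  \int[lebesgue_measure]_(x in `[0, +oo[) (gauss_kernel T x * u 0 x).
Proof.
have ig : (@lebesgue_measure R).-integrable `[0, +oo[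
    (EFin \o (fun x => M * gauss_kernel T x)).
  by apply: integrable_cstM => //; exact: integrable_gauss_kernel.
apply: (cvg_Rintegral_segments (a := fun=> 0) _ _ _ _ _ _ _ ig) => //.
- by move=> n x; rewrite /= !in_itv/= andbT => /andP[].
- move=> n x /andP[x0 xd]; apply: cvgM; last first.
    apply: (@continuous_comp _ _ _ (fun x => x + d n) (u (d n))).
      by apply: cvgD; [exact: cvg_id|exact: cvg_cst].
    by apply: u_section => //; rewrite ltr_wpDl.
  apply: cvgM; first exact: is_derive_continuous (is_derive_cutoff _ _).
  exact: is_derive_continuous (is_derive_gauss_kernel_space _ _).
- move=> x; rewrite /= in_itv/= andbT => x0.
  have : \forall n \near \oo, d n * x < 1 by exact: (cvgr_lt _ (d_cvg0M x)).
  apply: filterS => n dx1.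
  by rewrite x0/= -[leRHS]mulr1 ler_pdivlMl// ltW.
- move=> x; rewrite /= in_itv/= andbT => x0.
  rewrite [X in _ --> X](_ : _ = 1 * gauss_kernel T x * u 0 x); last by rewrite mul1r.
  apply: cvgM.
    by apply: cvgM; [exact: (@cutoff_cvg1 (fun=> x) (d_cvg0M x))|exact: cvg_cst].
  apply: (@cvg_within_comp R Q _ _ _ _ d (fun n => x + d n) 0 x u_cont) => //.
  + exact: QP.
  + by apply: nearW => n; apply: QP; rewrite ?addr_ge0// ltW.
  + by rewrite -[X in _ --> X]addr0; apply: cvgD; [exact: cvg_cst|].
- move=> n x /[dup] xd /andP[x0 _]; rewrite mulrC normrM; apply: ler_pM => //.
    by apply: u_le => //; rewrite ltr_wpDl.
  rewrite normrM (ger0_norm (gauss_kernel_ge0 _ _)) ler_piMl ?gauss_kernel_ge0//.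
  exact: norm_cutoff_le1.
- by move=> x _; rewrite mulr_ge0 ?gauss_kernel_ge0.
Qed.

(** The kernels [gauss_kernel (d n)] concentrate at 0 and have no common integrable majorant; in the
    rescaled variable the Gaussian is fixed and 2 M e^(-y^2) dominates. *)
Lemma cvg_trace_integral :
  \int[lebesgue_measure]_(x in `[0, (d n)^-1])
    (cutoff (d n) x * gauss_kernel (d n) x * u T (x + d n)) @[n --> \oo] -->
  Num.sqrt pi * u T 0.
Proof.
pose c n := 2 * Num.sqrt (d n).
have c0 n : 0 < c n by rewrite mulr_gt0// sqrtr_gt0.
have c_cvg0 : c n @[n --> \oo] --> 0.
  rewrite -[X in _ --> X](mulr0 2) -[X in 2 * X](sqrtr0 R).
  apply: cvgM; first exact: cvg_cst.
  exact: (cvg_comp _ _ d_cvg0 (@sqrt_continuous R 0)).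
have cy_cvg0 y : c n * y @[n --> \oo] --> 0.
  by rewrite -[X in _ --> X](mul0r y); apply: cvgM => //; exact: cvg_cst.
have dcy_cvg0 y : d n * (c n * y) @[n --> \oo] --> 0.
  by rewrite -[X in _ --> X](mul0r 0); exact: cvgM.
pose b n := (d n)^-1 / c n.
have b0 n : 0 <= b n by rewrite divr_ge0 ?invr_ge0// ltW.
have cb n : (d n)^-1 = c n * b n by rewrite mulrC divfK// gt_eqF.
(* The factor 2 is what remains of dx = 2 sqrt(d) dy against the 1 / sqrt d of the kernel; against
   the half-line integral sqrt(pi)/2 it leaves sqrt(pi). *)
pose f_ n y := 2 * (cutoff (d n) (c n * y) * expR (- y ^+ 2) * u T (c n * y + d n)).
have u_shift n x : 0 <= x -> {for x, continuous (fun x => u T (x + d n))}.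
  move=> x0; apply: (@continuous_comp _ _ _ (fun x => x + d n) (u T)).
    by apply: cvgD; [exact: cvg_id|exact: cvg_cst].
  by apply: u_section => //; rewrite ltr_wpDl.
have cf n y : 0 <= y <= b n -> {for y, continuous (f_ n)}.
  move=> /andP[y0 _].
  have cc : {for y, continuous (fun y => c n * y)}.
    by apply: cvgM; [exact: cvg_cst|exact: cvg_id].
  apply: cvgM; first exact: cvg_cst.
  apply: cvgM; last first.
    apply: (@continuous_comp _ _ _ (fun y => c n * y) (fun x => u T (x + d n))) => //.
    by apply: u_shift; rewrite mulr_ge0// ltW.
  apply: cvgM; last exact: continuous_gauss_fun.
  apply: (@continuous_comp _ _ _ (fun y => c n * y) (cutoff (d n))) => //.
  exact: is_derive_continuous (is_derive_cutoff _ _).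
rewrite [X in X @ _ --> _](_ : _ =
    (fun n => \int[lebesgue_measure]_(y in `[0, b n]) f_ n y)); last first.
  apply/funext => n; rewrite [in LHS]cb Rintegral_scale//; last first.
    move=> x /andP[x0 _]; apply: cvgM; last exact: u_shift.
    apply: cvgM; first exact: is_derive_continuous (is_derive_cutoff _ _).
    exact: is_derive_continuous (is_derive_gauss_kernel_space _ _).
  transitivity (c n * \int[lebesgue_measure]_(y in `[0, b n]) ((c n)^-1 * f_ n y)).
    congr (_ * _); apply: eq_Rintegral => y _.
    have sd0 : Num.sqrt (d n) != 0 by rewrite gt_eqF// sqrtr_gt0.
    rewrite /f_ /gauss_kernel (_ : (c n * y) ^+ 2 / (4 * d n) = y ^+ 2); last first.
      rewrite /c !exprMn sqr_sqrtr ?ltW//.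
      by field; rewrite gt_eqF.
    by rewrite /c; field; rewrite sd0.
  rewrite RintegralZl//; last exact: continuous_integrable_segment (cf n).
  by rewrite mulrA divff ?mul1r// gt_eqF.
have igauss k : (@lebesgue_measure R).-integrable `[0, +oo[
    (EFin \o (fun y => k * expR (- y ^+ 2))).
  by apply: integrable_cstM => //; exact: integrable_gauss0y.
have -> : Num.sqrt pi * u T 0 = \int[lebesgue_measure]_(y in `[0, +oo[)
    (2 * u T 0 * expR (- y ^+ 2)).
  rewrite RintegralZl//; last exact: integrable_gauss0y.
  by rewrite Rintegral_gauss0y; field.
apply: (cvg_Rintegral_segments (a := fun=> 0) _ _ cf _ _ _ _ (igauss (2 * M))).2 => //.
- by move=> n y; rewrite /= !in_itv/= andbT => /andP[].
- move=> y; rewrite /= in_itv/= andbT => y0.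
  have : \forall n \near \oo, d n * (c n * y) < 1 by exact: (cvgr_lt _ (dcy_cvg0 y)).
  apply: filterS => n dy1.
  rewrite y0/= /b ler_pdivlMr// -[leRHS]mulr1 ler_pdivlMl//.
  by rewrite [y * _]mulrC ltW.
- move=> y; rewrite /= in_itv/= andbT => y0.
  rewrite (_ : 2 * u T 0 * expR (- y ^+ 2) = 2 * (1 * expR (- y ^+ 2) * u T 0)); last by ring.
  apply: cvgM; first exact: cvg_cst.
  apply: cvgM.
    by apply: cvgM; [exact: (@cutoff_cvg1 (fun n => c n * y) (dcy_cvg0 y))|exact: cvg_cst].
  apply: (@cvg_within_comp R Q _ _ _ _ (fun=> T) (fun n => c n * y + d n) T 0 u_cont) => //.
  + by apply: QP => //; exact: ltW.
  + by apply: nearW => n; apply: QP; rewrite ?addr_ge0 ?mulr_ge0// ltW.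
  + exact: cvg_cst.
  + by rewrite -[X in _ --> X]addr0; exact: cvgD.
- move=> n y /andP[y0 yb].
  have cy : 0 <= c n * y <= (d n)^-1.
    by rewrite mulr_ge0 ?(ltW (c0 n))//= cb ler_pM2l.
  have uM : `|u T (c n * y + d n)| <= M.
    by apply: u_le => //; rewrite ltr_wpDl// (andP cy).1.
  have w1 := norm_cutoff_le1 (d_gt0 n) cy.
  rewrite /f_ normrM ger0_norm// -[leRHS]mulrA ler_pM2l// [leRHS]mulrC.
  rewrite normrM (normrM (cutoff _ _)) (ger0_norm (expR_ge0 _)).
  apply: ler_pM => //.
  by rewrite ler_piMl// expR_ge0.
- by move=> y _; rewrite !mulr_ge0// expR_ge0.
Qed.

Lemma cvg_flux_integral :
  (@lebesgue_measure R).-integrable `]0, T]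
    (EFin \o (fun s => (Num.sqrt s)^-1 * ux (T - s) 0)) /\
  \int[lebesgue_measure]_(s in `[d n, T])
    ((Num.sqrt s)^-1 * ux (T + d n - s) (d n)) @[n --> \oo] -->
  \int[lebesgue_measure]_(s in `]0, T]) ((Num.sqrt s)^-1 * ux (T - s) 0).
Proof.
(* For s in [[d n, T]] the time T + d n - s stays in [[d n, T]], and the abscissa d n is below T, so
   a bound of [ux] on one compact square covers all n, and K s^(-1/2) dominates. *)
have [K K0 uxK] : exists2 K, 0 <= K &
    forall t x, 0 <= t <= T -> 0 <= x <= T -> `|ux t x| <= K.
  have := @bounded_rectangle R (fun z => ux z.1 z.2) 0 T 0 T; apply.
  apply: continuous_subspaceW ux_cont => -[t x] [].
  by rewrite /= !in_itv/= => /andP[t0 _] /andP[x0 _]; exact: QP.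
have ig : (@lebesgue_measure R).-integrable `]0, T]
    (EFin \o (fun s => K * (Num.sqrt s)^-1)).
  by apply: integrable_cstM => //; exact: integrable_inv_sqrt.
apply: (cvg_Rintegral_segments (b := fun=> T) _ _ _ _ _ _ _ ig) => //.
- move=> n s; rewrite /= !in_itv/= => /andP[ds ->].
  by rewrite (lt_le_trans _ ds).
- move=> n s /andP[ds sT]; apply: cvgM.
    apply: cvgV; first by rewrite gt_eqF// sqrtr_gt0 (lt_le_trans _ ds).
    exact: sqrt_continuous.
  apply: (@continuous2_cvg _ _ _ _ _ _ (fun r => T + d n - r) (fun=> d n) ux
    (T + d n - s) (d n)).
  + apply: (within_quadrant_continuous ux_cont) => //.
      by move=> [t x] /= t0 x0; apply: QP; exact: ltW.
    by rewrite subr_gt0 (le_lt_trans sT)// ltrDl.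
  + by apply: cvgB; [exact: cvg_cst|exact: cvg_id].
  + exact: cvg_cst.
- move=> s; rewrite /= in_itv/= => /andP[s0 sT].
  have : \forall n \near \oo, d n < s by exact: (cvgr_lt _ d_cvg0).
  by apply: filterS => n ds; rewrite (ltW ds).
- move=> s; rewrite /= in_itv/= => /andP[s0 sT].
  apply: cvgM; first exact: cvg_cst.
  apply: (@cvg_within_comp R Q _ _ _ _ (fun n => T + d n - s) d (T - s) 0 ux_cont) => //.
  + by apply: QP; rewrite ?subr_ge0.
  + apply: nearW => n; apply: QP; last exact: ltW.
    by rewrite subr_ge0 (le_trans sT)// lerDl ltW.
  + rewrite [X in _ --> X](_ : _ = T + 0 - s); last by rewrite addr0.
    by apply: cvgB; [apply: cvgD => //; exact: cvg_cst|exact: cvg_cst].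
- move=> n s /andP[ds sT].
  rewrite normrM ger0_norm ?invr_ge0 ?sqrtr_ge0// mulrC.
  have dn := ltW (d_gt0 n).
  rewrite ler_wpM2r ?invr_ge0 ?sqrtr_ge0// uxK//; last by rewrite dn ltW.
  by apply/andP; split; lra.
- by move=> s _; rewrite mulr_ge0 ?invr_ge0 ?sqrtr_ge0.
Qed.

End boundary_limits.

(** * Boundary values and the representation formula *)

Theorem theorem2 (R : realType) (u : R -> R -> R)
  (u_regular : heat_regular u)
  (u_bounded : exists M : R, forall t x : R, 0 < t -> 0 < x -> `|u t x| <= M)
  (u_heat : forall t x : R, 0 < t -> 0 < x ->
     derive1 (u ^~ x) t - derive1n 2 (u t) x = 0) :
  exists v phi psi : R -> R,
    [/\ (forall x : R, 0 < x -> u t x @[t --> 0^'+] --> v x),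
        (forall t : R, 0 < t -> u t x @[x --> 0^'+] --> phi t) &
        (forall t : R, 0 < t -> derive1 (u t) x @[x --> 0^'+] --> psi t)] /\
    [/\ {within `]0, +oo[, continuous v},
        {within `]0, +oo[, continuous phi} &
        {within `]0, +oo[, continuous psi}] /\
    forall t : R, 0 < t ->
      [/\ lebesgue_measure.-integrable `]0, +oo[
            (EFin \o (fun xi : R => expR (- (xi ^+ 2 / (4 * t))) * v xi)),
          lebesgue_measure.-integrable `]0, t[
            (EFin \o (fun tau : R => (Num.sqrt tau)^-1 * psi (t - tau))) &
          phi t =
            (Num.sqrt (pi * t))^-1 *
              (\int[lebesgue_measure]_(xi in `]0, +oo[)
                 (expR (- (xi ^+ 2 / (4 * t))) * v xi))
            - (Num.sqrt pi)^-1 *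
              (\int[lebesgue_measure]_(tau in `]0, t[)
                 ((Num.sqrt tau)^-1 * psi (t - tau)))].
Proof.
have [u_cont [u_dwithin ux_cont] [ux_derivable uxx_cont] [u_dt uxx_dt_cont]] := u_regular.
have [M u_le] := u_bounded.
pose ux (t x : R) := derive_within `[0, +oo[ (u t) x.
pose uxx (t x : R) := derive1n 2 (u t) x.
pose Q : set (R * R) := `[0, +oo[ `*` `[0, +oo[.
have {}ux_cont : {within Q, continuous (fun p : R * R => ux p.1 p.2)} by [].
have QP (t x : R) : 0 <= t -> 0 <= x -> Q (t, x).
  by move=> t0 x0; split; rewrite /= in_itv/= andbT.
have u_dx (t x : R) : 0 <= t -> 0 < x -> is_derive x 1 (u t) (ux t x).
  by move=> t0 x0; apply: is_derive_within => //; apply: u_dwithin => //; exact: ltW.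
have uxE (t x : R) : 0 <= t -> 0 < x -> derive1 (u t) x = ux t x.
  by move=> t0 x0; rewrite derive1E; have [_ ->] := u_dx _ _ t0 x0.
have ux_dx (t x : R) : 0 < t -> 0 < x -> is_derive x 1 (ux t) (uxx t x).
  (* The one-sided [ux t] and [derive1 (u t)] are known to agree at positive points only, which is
     enough for derivatives at x > 0. *)
  move=> t0 x0; apply: (@near_eq_is_derive _ _ _ (derive1 (u t))).
    near=> y; apply: uxE; first exact: ltW.
    by near: y; exact: lt_nbhsr.
  by split; [exact/ux_derivable/x0/ltW|rewrite -derive1E].
have u_dtE (t x : R) : 0 < t -> 0 < x -> is_derive t 1 (u ^~ x) (uxx t x).
  move=> t0 x0; split; first exact: u_dt.
  by rewrite -derive1E; apply/eqP; rewrite -subr_eq0 u_heat.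
have posQ (z : R * R) : 0 < z.1 -> 0 < z.2 -> Q z.
  by case: z => t x /= t0 x0; apply: QP; exact: ltW.
have u_at (t x : R) : 0 < t -> 0 < x ->
    {for (t, x), continuous (fun z : R * R => u z.1 z.2)}.
  by move=> t0 x0; exact: within_quadrant_continuous u_cont posQ t0 x0.
have ux_at (t x : R) : 0 < t -> 0 < x ->
    {for (t, x), continuous (fun z : R * R => ux z.1 z.2)}.
  by move=> t0 x0; exact: within_quadrant_continuous ux_cont posQ t0 x0.
have uxx_at (t x : R) : 0 < t -> 0 < x ->
    {for (t, x), continuous (fun z : R * R => uxx z.1 z.2)}.
  move=> t0 x0; apply: (within_quadrant_continuous uxx_cont) => // -[s y] /= s0 y0.
  by split; rewrite /= in_itv/= andbT// ltW.
(* Joint continuity up to the boundary makes the boundary values plain restrictions. For psi the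
   one-sided derivative is required: [derive1 (u t) 0] would depend on values of [u t] at negative
   points. *)
exists (u 0), (u ^~ 0), (ux ^~ 0); split; [split|split; [split|]].
- move=> x x0; apply: (@cvg_within_comp R Q _ _ _ _ id (fun=> x) 0 x u_cont).
  + by apply: QP => //; exact: ltW.
  + by near=> t; apply: QP; apply/ltW => //; near: t; exact: nbhs_right_gt.
  + exact: cvg_at_right_filter.
  + exact: cvg_cst.
- move=> t t0; apply: (@cvg_within_comp R Q _ _ _ _ (fun=> t) id t 0 u_cont).
  + by apply: QP => //; exact: ltW.
  + by near=> x; apply: QP; apply/ltW => //; near: x; exact: nbhs_right_gt.
  + exact: cvg_cst.
  + exact: cvg_at_right_filter.
- move=> t t0.
  apply: (@cvg_trans _ (ux t x @[x --> 0^'+])).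
    apply: near_eq_cvg; near=> x; apply/esym/uxE; first exact: ltW.
    by near: x; exact: nbhs_right_gt.
  apply: (@cvg_within_comp R Q _ _ _ _ (fun=> t) id t 0 ux_cont).
  + by apply: QP => //; exact: ltW.
  + by near=> x; apply: QP; apply/ltW => //; near: x; exact: nbhs_right_gt.
  + exact: cvg_cst.
  + exact: cvg_at_right_filter.
- apply: continuous_in_subspaceT => x; rewrite inE/= in_itv/= andbT => x0.
  apply: (@cvg_within_comp R Q _ _ _ _ (fun=> 0) id 0 x u_cont).
  + by apply: QP => //; exact: ltW.
  + by near=> y; apply: QP => //; apply/ltW; near: y; exact: lt_nbhsr.
  + exact: cvg_cst.
  + exact: cvg_id.
- apply: continuous_in_subspaceT => t; rewrite inE/= in_itv/= andbT => t0.
  apply: (@cvg_within_comp R Q _ _ _ _ id (fun=> 0) t 0 u_cont).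
  + by apply: QP => //; exact: ltW.
  + by near=> s; apply: QP => //; apply/ltW; near: s; exact: lt_nbhsr.
  + exact: cvg_id.
  + exact: cvg_cst.
- apply: continuous_in_subspaceT => t; rewrite inE/= in_itv/= andbT => t0.
  apply: (@cvg_within_comp R Q _ _ _ _ id (fun=> 0) t 0 ux_cont).
  + by apply: QP => //; exact: ltW.
  + by near=> s; apply: QP => //; apply/ltW; near: s; exact: lt_nbhsr.
  + exact: cvg_id.
  + exact: cvg_cst.
move=> T T0.
(* The offset 2 ensures d n < T already at n = 0. *)
pose d n : R := T / n.+2%:R.
have d0 n : 0 < d n by rewrite divr_gt0.
have dT n : d n < T by rewrite ltr_pdivrMr// ltr_pMr// ltr1n.
have d_cvg0 : d n @[n --> \oo] --> 0.
  rewrite -[X in _ --> X](mulr0 T); apply: cvgM; first exact: cvg_cst.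
  have := @cvg_harmonic R; rewrite -(cvg_shiftn 1) /harmonic.
  by under eq_fun do rewrite addn1.
have [iA cvgA] := cvg_initial_integral u_le u_cont T0 d0 d_cvg0.
have cvgBt := cvg_trace_integral u_le u_cont T0 d0 d_cvg0.
have [iC cvgC] := cvg_flux_integral (ux := ux) ux_cont T0 d0 dT d_cvg0.
have estimate n := heat_cutoff_estimate u_le
  (fun t x t0 => u_dx t x (ltW t0)) ux_dx u_dtE u_at ux_at uxx_at (d0 n) (dT n).
have M0 : 0 <= M by exact: le_trans (u_le _ _ T0 T0).
have bound_cvg0 : 24 * M * T * Num.sqrt (d n) @[n --> \oo] --> 0.
  rewrite -[X in _ --> X](mulr0 (24 * M * T)); apply: cvgM; first exact: cvg_cst.
  by rewrite -[X in _ --> X](sqrtr0 R); exact: (cvg_comp _ _ d_cvg0 (@sqrt_continuous R 0)).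
(* Here d / sqrt d = sqrt d and T - d <= T, so the error bound is dominated by one that visibly
   tends to 0. *)
have bound n : 24 * M * d n * (Num.sqrt (d n))^-1 * (T - d n)
    <= 24 * M * T * Num.sqrt (d n).
  have q0 : 0 < Num.sqrt (d n) by rewrite sqrtr_gt0.
  rewrite [leLHS](_ : _ = 24 * M * Num.sqrt (d n) * (T - d n)); last first.
    rewrite -[X in _ * X / _ * _](@sqr_sqrtr R) ?ltW//.
    by field; rewrite gt_eqF.
  have c0 : 0 <= 24 * M * Num.sqrt (d n) by rewrite !mulr_ge0.
  by rewrite [leRHS]mulrAC ler_wpM2l// gerBl ltW.
have [iI IE] := integrable_gauss_kernelM T0 iA.
have iJ : (@lebesgue_measure R).-integrable `]0, T[
    (EFin \o (fun s => (Num.sqrt s)^-1 * ux (T - s) 0)).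
  apply: integrableS iC => //.
  by apply: subset_itvl; rewrite bnd_simp.
split=> //.
(* Passing to the limit in the estimate leaves an absolute value bounded by 0, that is, the formula
   multiplied by sqrt(pi). *)
have : `|\int[lebesgue_measure]_(x in `[0, +oo[) (gauss_kernel T x * u 0 x)
    - Num.sqrt pi * u T 0
    - \int[lebesgue_measure]_(s in `]0, T]) ((Num.sqrt s)^-1 * ux (T - s) 0)| <= 0.
  apply: ler_cvg_to (cvg_norm (cvgB (cvgB cvgA cvgBt) cvgC)) bound_cvg0 _.
  by apply: nearW => n; exact: le_trans (estimate n) (bound n).
rewrite IE -Rintegral_itv_bndo_bndc//.
move=> E.
rewrite sqrtrM ?pi_ge0//.
have sT : Num.sqrt T != 0 by rewrite gt_eqF// sqrtr_gt0.
have sp : Num.sqrt (pi : R) != 0 by rewrite gt_eqF// sqrtr_gt0 pi_gt0.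
apply: (mulfI sp).
rewrite mulrBr invfM !mulrA divff// !mul1r.
move: E; rewrite normr_le0 subr_eq0 subr_eq => /eqP->.
by rewrite addrC addKr.
Unshelve. all: by end_near.
Qed.
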